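(* Let $q$ be an odd prime power and let $B\subset\mathbb{P}^2$ be the Ballico-Hefez curve over $\mathbb{F}_q$, i.e. the image of $\Phi:\mathbb{P}^1\to\mathbb{P}^2$, $\Phi(s,t)=(s^{q+1},\,s^{q}t+st^{q},\,t^{q+1})$. For each integer $i\ge 0$ let $\tau_i$ be the number of $\mathbb{F}_q$-lines $l$ in $\mathbb{P}^2$ with $\#\left(B(\mathbb{F}_q)\cap l\right)=i$. Then: (i) If $\tau_i\neq 0$, then $i=1$ or $i=\frac{q+1}{2}$ or $i=\frac{q+3}{2}$. (ii) $\tau_1=q+1$; $\tau_{\frac{q+1}{2}}=\frac{q(q-1)}{2}$; $\tau_{\frac{q+3}{2}}=\frac{q(q+1)}{2}$.
   Context: $B(\mathbb{F}_q)$ is the set of points of $B$ in $\mathbb{P}^2(\mathbb{F}_q)$. An $\mathbb{F}_q$-line is a line of $\mathbb{P}^2$ defined over $\mathbb{F}_q$. *)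

(* Defs.v *)
From HB Require Import structures.
From mathcomp Require Import all_boot all_order all_algebra.
From mathcomp Require Import boolp.

Set Implicit Arguments.
Unset Strict Implicit.
Unset Printing Implicit Defensive.

Import GRing.Theory VectorInternalTheory.
Local Open Scope ring_scope.

(* VectorInternalTheory provides the subType structure of {vspace _}. *)
HB.instance Definition _ (F : finFieldType) (n : nat) :=
  [Finite of {vspace 'rV[F]_n} by <:].

(* P^2 over a field E is modelled by the subspaces of E^3: the points are the
   subspaces of dimension 1, the lines those of dimension 2, and incidence is
   inclusion. *)
Notation plane E := {vspace 'rV[E]_3}.

Definition is_point (E : fieldType) (P : plane E) : bool := \dim P == 1%N.

Definition is_line (E : fieldType) (l : plane E) : bool := \dim l == 2%N.

Definition BH_map (E : fieldType) (q : nat) (s t : E) : 'rV[E]_3 :=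
  \row_(j < 3) [:: s ^+ q.+1; s ^+ q * t + s * t ^+ q; t ^+ q.+1]`_j.

(* To be used over an algebraically closed field: geometric points of the
   image of P^1. *)
Definition BH_curve (E : fieldType) (q : nat) (P : plane E) : Prop :=
  exists s t : E, ((s != 0) || (t != 0)) /\ P = <[BH_map q s t]>%VS.

Definition extend_scalars (F K : fieldType) (iota : {rmorphism F -> K})
    (P : plane F) : plane K :=
  <<[seq map_mx iota v | v <- vbasis P]>>%VS.

(* The F-rational points of the curve.  Membership is tested over K because
   such a point may only have preimages in P^1 that are not F-rational: for
   F = F_q, the point Phi(1, t) = (1 : t + t^q : t^(q+1)) is rational for every
   t in F_(q^2). *)
Definition BH_rational_points (F : finFieldType) (K : closedFieldType)
    (iota : {rmorphism F -> K}) (q : nat) : {set plane F} :=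
  [set P : plane F | is_point P & `[< BH_curve q (extend_scalars iota P) >]].

Definition tau (F : finFieldType) (K : closedFieldType)
    (iota : {rmorphism F -> K}) (q i : nat) : nat :=
  #|[set l : plane F | is_line l &
      #|[set P in BH_rational_points iota q | (P <= l)%VS]| == i]|.

(* Main.v *)
Require Import Defs.
From HB Require Import structures.
From mathcomp Require Import all_boot all_order all_algebra.
From mathcomp Require abelian.
From mathcomp Require Import finfield.
From mathcomp Require Import boolp ring zify.

(** Up to scaling, a point of the curve other than [(0 : 0 : 1)] is
    [(1 : t + t^q : t^(q+1))].  It is rational over [F = F_q] exactly when [t]
    and [t^q] are the two roots of a polynomial [X^2 - y X + z] over [F].
    Frobenius then fixes both roots (and [t = t^q]) or exchanges them, so the
    discriminant [y^2 - 4 z] is zero or a nonsquare; conversely, if it is zero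
    or a nonsquare, Frobenius sends each of its square roots to the opposite,
    hence the two roots of the polynomial are [t] and [t^q]
    ([trace_normP]).  Thus [B(F_q)] consists of the points at which the
    quadratic form [Q = y^2 - 4 x z] is not a nonzero square
    ([BH_rational_pointsP]): those of the conic [Q = 0] and the points inside
    it.

    A line that avoids [(0 : 0 : 1)] is [z = - a x - b y]; there, with [x = 1]
    and after completing the square, [Q] is [Y^2 - D] with
    [D = 4 (b^2 - a)], and the point with [x = 0] has [Q = 1].  So the line
    meets [B(F_q)] in as many points as there are [Y] for which [Y^2 - D] is
    not a nonzero square.  This is [1] if [D = 0]; otherwise the hyperbola
    [Y^2 - d^2 = D] has [q - 1] points, two for each [Y] with [Y^2 - D] a
    nonzero square, apart from the points with [d = 0], which exist when [D]
    is a square ([double_card_hyperbola]).  This gives [(q + 3) / 2] points if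
    [D] is a nonzero square and [(q + 1) / 2] if it is not.  The lines through
    [(0 : 0 : 1)] are secant to the conic, except for the tangent [x = 0].

    As [(a, b)] varies, each [D] is taken [q] times.  Adding the [q] secants
    and the tangent through [(0 : 0 : 1)], the counts of tangent, secant and
    exterior lines are [q + 1], [q (q - 1) / 2 + q] and [q (q - 1) / 2]. *)

Set Implicit Arguments.
Unset Strict Implicit.
Unset Printing Implicit Defensive.

Import GRing.Theory.
Local Open Scope ring_scope.

(** * Squares in a finite field of odd order *)

Lemma pnat_card_finField (F : finFieldType) :
  [pchar F].-nat #|F|.
Proof.
have [p _ pcharF] := finPcharP F.
rewrite (eq_pnat _ (pcharf_eq pcharF)) -cardsT.
exact/abelian.abelem_pgroup/abelian.fin_ring_pchar_abelem.
Qed.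

Lemma two_neq0 (F : finFieldType) : odd #|F| -> 2%:R != 0 :> F.
Proof.
move=> oddF; apply/negP => two0.
have pchar2 : 2%N \in [pchar F] by rewrite inE /= two0.
have := pnat_card_finField F; rewrite (eq_pnat _ (pcharf_eq pchar2)) => q2.
have := finNzRing_gt1 F; rewrite (pnat_1 q2) //.
by rewrite -odd_2'nat.
Qed.

Definition nzsq (F : finFieldType) (a : F) : bool :=
  [exists d, (d != 0) && (d ^+ 2 == a)].

Lemma nzsqP (F : finFieldType) (a : F) :
  reflect (exists2 d, d != 0 & a = d ^+ 2) (nzsq a).
Proof.
apply: (iffP existsP) => [[d /andP[d0 /eqP <-]]|[d d0 ->]]; exists d => //.
by rewrite d0 eqxx.
Qed.

Section Counting.
Variable F : finFieldType.
Hypothesis two0 : 2%:R != 0 :> F.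

Lemma card_sqrts (a : F) :
  #|[set d | (d != 0) && (d ^+ 2 == a)]| = (2 * nzsq a)%N.
Proof.
case: nzsqP => [[c c0 ->]|nsq]; last first.
  apply: eq_card0 => d; rewrite inE; apply/negP => /andP[d0 /eqP e].
  by apply: nsq; exists d.
rewrite muln1 (_ : [set _ | _] = [set c; - c]).
  rewrite cards2; suff -> : c != - c by [].
  by rewrite -subr_eq0 opprK -mulr2n -mulr_natl mulf_neq0.
apply/setP => d; rewrite !inE eqf_sqr.
case: (eqVneq d c) => [->|_] /=; first by rewrite c0.
by case: (eqVneq d (- c)) => [->|]; rewrite ?oppr_eq0 ?c0 ?andbF.
Qed.

(** Each nonzero square has two square roots, so counting pairs [(x, d)] with
    [d^2 = f x] replaces a count of squares by a count of points of a curve. *)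
Lemma double_card_nzsq (T : finType) (f : T -> F) :
  (2 * #|[set x | nzsq (f x)]|)%N =
  #|[set p : T * F | (p.2 != 0) && (p.2 ^+ 2 == f p.1)]|.
Proof.
rewrite -!sum1dep_card big_mkcond big_distrr /=.
rewrite (eq_bigr
  (fun x => \sum_(d | (d != 0) && (d ^+ 2 == f x)) 1%N)); last first.
  by move=> x _; rewrite sum1dep_card card_sqrts; case: nzsq.
by rewrite pair_big_dep.
Qed.

Lemma card_nonzero : #|[set x : F | x != 0]| = #|F|.-1.
Proof. by rewrite cardsE cardC1. Qed.

Lemma double_card_squares : (2 * #|[set a : F | nzsq a]|)%N = #|F|.-1.
Proof.
rewrite double_card_nzsq -card_nonzero.
rewrite -(@card_imset _ _ (fun d : F => (d ^+ 2, d))); last by move=> c d [].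
apply: eq_card => -[a d]; rewrite !inE /=.
apply/andP/imsetP => [[d0 /eqP <-]|[c]]; first by exists d; rewrite ?inE.
by rewrite inE => c0 [-> ->].
Qed.

(** [u |-> (y, d)] with [y + d = u] and [y - d = D / u] identifies the nonzero
    scalars with the points of the hyperbola [y^2 - d^2 = D]; those with
    [d = 0] are counted by the second summand. *)
Lemma double_card_hyperbola (D : F) : D != 0 ->
  (2 * #|[set y : F | nzsq (y ^+ 2 - D)%R]| + 2 * nzsq D)%N = #|F|.-1.
Proof.
move=> D0; rewrite double_card_nzsq -card_nonzero -card_sqrts.
have inj : injective (fun u : F => ((u + D / u) / 2%:R, (u - D / u) / 2%:R)).
  move=> u v [e1 e2].
  have half (w : F) : w = (w + D / w) / 2%:R + (w - D / w) / 2%:R.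
    by move: (D / w) => z; field.
  by rewrite (half u) e1 e2 -half.
rewrite -(card_imset _ inj).
rewrite -(@card_imset _ _ (fun d : F => (d, 0 : F))); last by move=> c d [].
rewrite -cardsUI [X in (_ + X)%N]eq_card0 ?addn0; last first.
  move=> [y d]; rewrite !inE /=; apply/negP => /andP[/andP[d0 _]].
  by case/imsetP => c _ [_ e]; rewrite e eqxx in d0.
apply: eq_card => -[y d]; rewrite !inE /=.
apply/orP/imsetP => [|[u]]; last first.
  rewrite inE => u0 [-> ->].
  case: (eqVneq ((u - D / u) / 2) 0) => [e|n0]; [right|left].
    apply/imsetP; exists ((u + D / u) / 2); last by rewrite e.
    have e' : D / u = u.
      apply/eqP; rewrite eq_sym -subr_eq0; move/eqP: e.
      by rewrite mulf_eq0 invr_eq0 (negPf two0) orbF.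
    have -> : (u + D / u) / 2 = u by rewrite e'; field.
    by rewrite inE u0 -[X in _ == X](mulfVK u0) e' expr2 eqxx.
  by apply/andP; split; [|apply/eqP; field; rewrite u0 two0].
case=> [/andP[d0 /eqP e]|/imsetP[c]].
  have e1 : D = (y + d) * (y - d) by rewrite -[LHS](subKr (y^+2)) -e; ring.
  have u0 : y + d != 0.
    by move: D0; rewrite e1; apply: contraNneq => ->; rewrite mul0r.
  exists (y + d); first by rewrite inE.
  rewrite e1; congr (_, _); field; exact/andP.
rewrite inE => /andP[c0 /eqP e] [-> ->]; exists c; first by rewrite inE.
by rewrite -e; congr (_, _); field; exact/andP.
Qed.
End Counting.

(** * Points and lines in coordinates *)

Definition vec3 (E : fieldType) (x y z : E) : 'rV[E]_3 :=
  \row_(j < 3) [:: x; y; z]`_j.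

(** The line of all [v] with [v . w = 0]; [w] is its vector of coefficients. *)
Definition dual_line (E : fieldType) (w : 'rV[E]_3) : plane E :=
  lker (linfun (mulmxr w^T : 'rV[E]_3 -> 'M[E]_1)).

Section Vec3.
Variable E : fieldType.
Implicit Types (v w : 'rV[E]_3) (l : plane E).

Lemma vec3_eta w : w = vec3 (w 0 0) (w 0 1) (w 0 2).
Proof.
apply/rowP => j; rewrite mxE.
by case: j => [[|[|[|]]]] //= h; congr (w _ _); apply: val_inj.
Qed.

Lemma vec3_inj (x y z x' y' z' : E) :
  vec3 x y z = vec3 x' y' z' -> [/\ x = x', y = y' & z = z'].
Proof.
move=> /rowP e; have := e 0; have := e 1; have := e 2.
by rewrite !mxE.
Qed.

Lemma scale_vec3 (k x y z : E) : k *: vec3 x y z = vec3 (k * x) (k * y) (k * z).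
Proof. by rewrite [LHS]vec3_eta !mxE. Qed.

Lemma vec3_eq0 (x y z : E) : (vec3 x y z == 0) = [&& x == 0, y == 0 & z == 0].
Proof.
have -> : 0 = vec3 0 0 0 :> 'rV[E]_3 by rewrite [LHS]vec3_eta !mxE.
apply/eqP/and3P => [/vec3_inj[-> -> ->]|[/eqP-> /eqP-> /eqP->]] //.
Qed.

Lemma mem_dual_line v w : (v \in dual_line w) = (v *m w^T == 0).
Proof. by rewrite memv_ker lfunE. Qed.

Lemma vec3_dual_line (x y z a b c : E) :
  (vec3 x y z \in dual_line (vec3 a b c)) = (a * x + b * y + c * z == 0).
Proof.
rewrite mem_dual_line; apply/eqP/eqP => [/matrixP/(_ 0 0)|e].
  by rewrite !mxE !big_ord_recr big_ord0 /= !mxE /= => <-; ring.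
apply/matrixP => i j; rewrite !mxE !big_ord_recr big_ord0 /= !mxE /=.
by rewrite -[RHS]e; ring.
Qed.

Lemma dual_lineZ (k : E) w : k != 0 -> dual_line (k *: w) = dual_line w.
Proof.
move=> k0; apply/vspaceP => v.
by rewrite !mem_dual_line linearZ -scalemxAr scaler_eq0 (negPf k0).
Qed.

Lemma dim_dual_line w : w != 0 -> \dim (dual_line w) = 2%N.
Proof.
move=> w0.
have := limg_ker_dim (linfun (mulmxr w^T : 'rV[E]_3 -> 'M[E]_1)) fullv.
rewrite capfv dimvf /dim /= mul1n -/(dual_line w) => e.
set d := \dim (limg _) in e.
suff d1 : d = 1%N by move: e; rewrite d1 addn1 => -[].
apply/eqP; rewrite eqn_leq; apply/andP; split.
  by rewrite (leq_trans (dimvS (subvf _))) // dimvf.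
rewrite lt0n dimv_eq0; apply: contra w0 => /eqP im0.
apply/eqP/rowP => j; have : delta_mx 0 j \in dual_line w.
  by rewrite memv_ker -memv0 -im0 memv_img ?memvf.
by rewrite mem_dual_line => /eqP/matrixP/(_ 0 0); rewrite -rowE !mxE.
Qed.

(** A matrix whose rows span [l] has rank 2, so a nonzero [w] is orthogonal to
    them, and [l] is equal to [dual_line w] by dimension. *)
Lemma lineP l : reflect (exists2 w, w != 0 & l = dual_line w) (is_line l).
Proof.
apply: (iffP eqP) => [dl|[w w0 ->]]; last exact: dim_dual_line.
pose A : 'M[E]_(\dim l, 3) := \matrix_(i < \dim l) (vbasis l)`_i.
have /rowV0Pn[w /sub_kermxP wA w0] : kermx A^T != 0.
  rewrite kermx_eq0 -row_leq_rank -ltnNge.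
  by rewrite (leq_ltn_trans (rank_leq_col _)) ?dl.
exists w => //; apply/eqP; rewrite eqEdim dim_dual_line // dl leqnn andbT.
apply/subvP => v /coord_vbasis ->; apply: memv_suml => i _; apply: memvZ.
rewrite mem_dual_line -(can_eq trmxK) trmx_mul trmxK trmx0.
apply/eqP/rowP => j; rewrite ord1.
have /rowP/(_ i) := wA; rewrite !mxE => e.
by apply: etrans e; apply: eq_bigr => k _; rewrite !mxE.
Qed.

Lemma pointP l : reflect (exists2 v, v != 0 & l = <[v]>%VS) (is_point l).
Proof.
apply: (iffP eqP) => [dl|[v v0 ->]]; last by rewrite dim_vline v0.
have v0 : vpick l != 0 by rewrite vpick0 -dimv_eq0 dl.
exists (vpick l) => //; apply/esym/eqP.
by rewrite eqEdim -memvE memv_pick dl dim_vline v0.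
Qed.

Lemma vlineZ (k : E) v : k != 0 -> <[k *: v]>%VS = <[v]>%VS.
Proof.
move=> k0; apply/eqP; rewrite eqEsubv -!memvE memvZ ?memv_line //=.
by apply/vlineP; exists k^-1; rewrite scalerK.
Qed.

Lemma eq_vlineP v w : v != 0 ->
  <[v]>%VS = <[w]>%VS -> exists2 k : E, k != 0 & v = k *: w.
Proof.
move=> v0 e; have /vlineP[k vk] : v \in <[w]>%VS by rewrite -e memv_line.
by exists k => //; apply: contraNneq v0 => k0; rewrite vk k0 scale0r.
Qed.

End Vec3.

Lemma map_vec3 (E E' : fieldType) (f : {rmorphism E -> E'}) (x y z : E) :
  map_mx f (vec3 x y z) = vec3 (f x) (f y) (f z).
Proof. by rewrite [LHS]vec3_eta !mxE. Qed.

(** The basis chosen for [<[v]>] is a single vector, known only to be a nonzero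
    multiple of [v]. *)
Lemma extend_scalars_line (F K : fieldType) (iota : {rmorphism F -> K})
    (v : 'rV[F]_3) :
  v != 0 -> extend_scalars iota <[v]> = <[map_mx iota v]>%VS.
Proof.
move=> v0; rewrite /extend_scalars.
have b := vbasisP <[v]>%VS.
have : size (vbasis <[v]>%VS) = 1%N by rewrite size_tuple dim_vline v0.
case: (tval (vbasis _)) b => [|u [|]] //= b _.
have u0 : u != 0 by apply: basis_not0 b _; rewrite inE.
have /(eq_vlineP u0)[k k0 ->] : <[u]>%VS = <[v]>%VS.
  by rewrite -span_seq1 (span_basis b).
by rewrite span_seq1 map_mxZ vlineZ ?fmorph_eq0.
Qed.

(** * The rational points of the curve *)

Section RationalPoints.
Variables (F : finFieldType) (K : closedFieldType).
Variable iota : {rmorphism F -> K}.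
Hypothesis two0 : 2%:R != 0 :> F.

(** Raising to the power [#|F|] is an iterate of Frobenius, as [#|F|] is a power
    of the characteristic. *)
Lemma exprD_card (x y : K) : (x + y) ^+ #|F| = x ^+ #|F| + y ^+ #|F|.
Proof.
apply: exprDn_pchar; rewrite (eq_pnat _ (fmorph_pchar iota)).
exact: pnat_card_finField.
Qed.

Lemma expr_card_rmorph (a : F) : iota a ^+ #|F| = iota a.
Proof. by rewrite -rmorphXn expf_card. Qed.

(** The elements of [F] already give [#|F|] roots of [X^#|F| - X]. *)
Lemma fixed_expr_card (x : K) : x ^+ #|F| = x -> exists a, x = iota a.
Proof.
move=> xq; have : (map_poly iota ('X^#|F| - 'X)).[x] = 0.
  by rewrite rmorphB /= map_polyXn map_polyX !hornerE xq subrr.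
rewrite finField_genPoly rmorph_prod horner_prod => /eqP.
case/prodf_eq0 => a _; rewrite rmorphB /= map_polyX map_polyC !hornerE subr_eq0.
by move/eqP => ->; exists a.
Qed.

Lemma sqrt_closed (x : K) : exists y : K, y ^+ 2 = x.
Proof.
have [y ye] := @solve_monicpoly K 2 (nth 0 [:: x]) isT.
by exists y; rewrite ye !big_ord_recr big_ord0 /= add0r expr0 mulr1 mul0r addr0.
Qed.

(** The roots of [X^2 - y X + z] are [t] and [t^q].  If the discriminant is a
    nonzero square, both are in [F], so [t = t^q] and the discriminant vanishes,
    a contradiction.  Otherwise let [dl] be a square root of it in [K]: then
    [dl^q] is [dl] or [- dl], and the first case puts [dl] in [F], hence
    [dl = 0].  So [dl^q = - dl], and [t = (y + dl) / 2] has conjugate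
    [(y - dl) / 2]. *)
Lemma trace_normP (y z : F) :
  (exists t : K, iota y = t + t ^+ #|F| /\ iota z = t ^+ #|F|.+1) <->
  ~~ nzsq (y ^+ 2 - 4%:R * z).
Proof.
have two0K : 2%:R != 0 :> K by rewrite -(rmorph_nat iota) fmorph_eq0.
have four0K : 4%:R != 0 :> K by rewrite (natrM _ 2 2) mulf_neq0.
split=> [[t [yt zt]]|nsq].
  apply/negP => /nzsqP[d d0 e].
  (* 4 (t^2 - y t + z) = 0 with the square completed. *)
  have : (2%:R * t - iota (y + d)) * (2%:R * t - iota (y - d)) = 0.
    have -> : (2%:R * t - iota (y + d)) * (2%:R * t - iota (y - d)) =
      4%:R * (t ^+ 2 - iota y * t) + iota (y ^+ 2 - d ^+ 2).
      by ring.
    rewrite -e subKr rmorphM /= rmorph_nat yt zt (exprS t #|F|); ring.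
  have fixt : forall a : F, 2%:R * t - iota a = 0 -> t ^+ #|F| = t.
    move=> a /subr0_eq ta; have -> : t = iota (a / 2%:R).
      by rewrite fmorph_div rmorph_nat -ta mulrC mulKf.
    exact: expr_card_rmorph.
  move/eqP; rewrite mulf_eq0 => h.
  have {h} tq : t ^+ #|F| = t by case/orP: h => /eqP; apply: fixt.
  have : iota (d ^+ 2) = 0.
    rewrite -e rmorphB rmorphXn rmorphM rmorph_nat /= yt zt (exprS t #|F|) tq.
    by ring.
  by move/eqP; rewrite fmorph_eq0 expf_eq0 (negPf d0) andbF.
have [dl dlE] := sqrt_closed (iota (y ^+ 2 - 4%:R * z)).
have dlq : dl ^+ #|F| = - dl.
  have : dl ^+ #|F| ^+ 2 == dl ^+ 2 by rewrite exprAC dlE expr_card_rmorph.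
  rewrite eqf_sqr => /orP[] /eqP // e.
  have [a ea] := fixed_expr_card e.
  have a2 : y ^+ 2 - 4%:R * z = a ^+ 2.
    by apply: (fmorph_inj iota); rewrite -dlE ea rmorphXn.
  suff a0 : a = 0 by rewrite e ea a0 rmorph0 oppr0.
  by apply: contraNeq nsq => a0; apply/nzsqP; exists a.
exists ((iota y + dl) / 2%:R).
have tq : ((iota y + dl) / 2%:R) ^+ #|F| = (iota y - dl) / 2%:R.
  rewrite exprMn exprD_card dlq expr_card_rmorph.
  by rewrite -(rmorph_nat iota) -fmorphV expr_card_rmorph.
rewrite exprS tq.
split; first by field.
have -> : (iota y + dl) / 2%:R * ((iota y - dl) / 2%:R) =
  (iota y ^+ 2 - dl ^+ 2) / 4%:R by field; rewrite two0K four0K.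
by rewrite dlE rmorphB rmorphXn rmorphM rmorph_nat /=; field; rewrite four0K.
Qed.

Definition affine_point (y z : F) : plane F := <[vec3 1 y z]>%VS.
Definition infinite_point : plane F := <[vec3 0 0 1]>%VS.

Lemma infinite_point_rational : infinite_point \in BH_rational_points iota #|F|.
Proof.
have v0 : vec3 0 0 1 != 0 :> 'rV[F]_3 by rewrite vec3_eq0 oner_eq0 !andbF.
rewrite inE; apply/andP; split; first by apply/pointP; eexists; first exact: v0.
apply/asboolP; exists 0, 1; rewrite oner_eq0 orbT; split=> //.
rewrite extend_scalars_line // map_vec3 !rmorph0 rmorph1.
congr (<[_]>%VS); rewrite /BH_map -/(vec3 _ _ _) !expr1n !exprS.
have -> : 0 ^+ #|F| = 0 :> K by rewrite expr0n; case: #|F| (finNzRing_gt1 F).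
by rewrite !mul0r addr0.
Qed.

(** The first coordinate [s^(q+1)] of a preimage is nonzero, so [(s, t)] can be
    replaced by [(1, t / s)]. *)
Lemma affine_point_rational (y z : F) :
  (affine_point y z \in BH_rational_points iota #|F|) =
  ~~ nzsq (y ^+ 2 - 4%:R * z).
Proof.
have v0 (E : fieldType) (y' z' : E) : vec3 1 y' z' != 0.
  by rewrite vec3_eq0 oner_eq0.
rewrite inE; have -> /= : is_point (affine_point y z).
  by apply/pointP; exists (vec3 1 y z); first exact: v0.
apply/asboolP/idP => [|/trace_normP [t [yt zt]]].
  rewrite /BH_curve extend_scalars_line // map_vec3 rmorph1.
  move=> [s [t [st0 /(eq_vlineP (v0 _ _ _))[k k0]]]].
  rewrite /BH_map -/(vec3 _ _ _) scale_vec3 => /vec3_inj[e0 e1 e2].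
  have s0 : s != 0.
    by apply: contra_eqN e0 => /eqP ->; rewrite expr0n mulr0 oner_eq0.
  apply/trace_normP; exists (t / s).
  have ks : k = (s ^+ #|F|.+1)^-1.
    by rewrite -[LHS](mulfK (expf_neq0 #|F|.+1 s0)) -e0 mul1r.
  have sq0 := expf_neq0 #|F| s0.
  by rewrite e1 e2 ks !exprMn !exprVn !exprS; split; field; rewrite ?s0 ?sq0.
exists 1, t; rewrite oner_eq0; split=> //.
rewrite extend_scalars_line // map_vec3 rmorph1.
by rewrite /BH_map -/(vec3 _ _ _) !expr1n !mul1r yt zt.
Qed.

(** On the curve, first coordinate zero means [s = 0], hence the single point
    [(0 : 0 : 1)]. *)
Lemma BH_rational_pointsP (P : plane F) :
  reflect (P = infinite_point \/
           exists y z, P = affine_point y z /\ ~~ nzsq (y ^+ 2 - 4%:R * z))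
    (P \in BH_rational_points iota #|F|).
Proof.
apply: (iffP idP) => [PB|[->|[y [z [-> nsq]]]]]; last 2 first.
- exact: infinite_point_rational.
- by rewrite affine_point_rational.
have : is_point P by move: PB; rewrite inE => /andP[].
case/pointP => v v0 defP; move: v0 defP PB.
rewrite (vec3_eta v); move: (v 0 0) (v 0 1) (v 0 2) => x y z v0 defP.
have [x0|x0] := eqVneq x 0; last first.
  have -> : P = affine_point (y / x) (z / x).
    rewrite defP -(@vlineZ _ x^-1) ?invr_eq0 // scale_vec3.
    by rewrite mulVf // ![x^-1 * _]mulrC.
  by rewrite affine_point_rational => nsq; right; exists (y / x), (z / x).
rewrite inE => /andP[_ /asboolP[s [t [st0]]]].
rewrite defP extend_scalars_line // map_vec3.
have w0 : vec3 (iota x) (iota y) (iota z) != 0.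
  by move: v0; rewrite !vec3_eq0 !fmorph_eq0.
move/(eq_vlineP w0) => [k k0].
rewrite /BH_map -/(vec3 _ _ _) scale_vec3 => /vec3_inj[e0 e1 e2].
have s0 : s = 0.
  move: e0; rewrite x0 rmorph0 => /esym/eqP.
  by rewrite mulf_eq0 (negPf k0) expf_eq0 => /andP[_ /eqP].
have sq0 : s ^+ #|F| = 0.
  by rewrite s0 expr0n; case: #|F| (finNzRing_gt1 F).
have y0 : y = 0.
  by apply/eqP; rewrite -(fmorph_eq0 iota) e1 sq0 s0 !mul0r addr0 mulr0.
left; rewrite x0 y0.
have z0 : z != 0 by move: v0; rewrite vec3_eq0 x0 y0 eqxx.
by rewrite -(vlineZ _ (invr_neq0 z0)) scale_vec3 !mulr0 mulVf.
Qed.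
End RationalPoints.

(** * Sections by lines *)

Lemma cardsNC (T : finType) (P : pred T) :
  #|[set x | ~~ P x]| = (#|T| - #|[set x | P x]|)%N.
Proof.
rewrite -(cardsC [set x | P x]) addKn; apply: eq_card => x.
by rewrite !inE.
Qed.

Lemma card_sum_type (T1 T2 : finType) (P : pred (T1 + T2)) :
  #|[set x | P x]| = (#|[set x | P (inl x)]| + #|[set x | P (inr x)]|)%N.
Proof. by rewrite -!sum1dep_card big_sumType. Qed.

Lemma card_set_const (T : finType) (b : bool) :
  #|[set x : T | b]| = (#|T| * b)%N.
Proof.
case: b; [rewrite muln1 -cardsT | rewrite muln0 -(cards0 T)].
all: by apply: eq_card => x; rewrite !inE.
Qed.

Section Lines.
Variables (F : finFieldType) (K : closedFieldType).
Variable iota : {rmorphism F -> K}.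
Hypothesis oddF : odd #|F|.
Let two0 : 2%:R != 0 :> F := two_neq0 oddF.
Let four0 : 4%:R != 0 :> F.
Proof. by rewrite (natrM _ 2 2) mulf_neq0. Qed.

Definition section_size (D : F) : nat :=
  if D == 0 then 1%N
  else if nzsq D then ((#|F| + 3) %/ 2)%N else ((#|F| + 1) %/ 2)%N.

Lemma card_not_nzsq_shift (D : F) :
  #|[set y : F | ~~ nzsq (y ^+ 2 - D)]| = section_size D.
Proof.
have q1 := finNzRing_gt1 F; rewrite /section_size; case: eqVneq => [->|D0].
  rewrite -[RHS](cards1 (0 : F)); apply: eq_card => y.
  rewrite !inE subr0; apply/idP/eqP => [|->]; first last.
    by apply/negP => /nzsqP[d d0 /esym/eqP]; rewrite expr0n expf_eq0 (negPf d0).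
  by apply: contraNeq => y0; apply/nzsqP; exists y.
rewrite cardsNC; have := double_card_hyperbola two0 D0.
by case: (nzsq D) => /=; move: oddF q1; move: #|F| #|_| => n m; lia.
Qed.

(** The summand [c == 0] tells whether the line contains the only rational point
    of the curve with first coordinate zero. *)
Lemma card_BH_dual_line (a b c : F) :
  #|[set P in BH_rational_points iota #|F| |
      (P <= dual_line (vec3 a b c))%VS]| =
  (#|[set p : F * F | (a + b * p.1 + c * p.2 == 0)%R &
       ~~ nzsq (p.1 ^+ 2 - 4%:R * p.2)%R]| + (c == 0%R))%N.
Proof.
have aff_inj : injective (fun p : F * F => affine_point p.1 p.2).
  move=> [y z] [y' z'] /= /eq_vlineP[|k k0].
    by rewrite vec3_eq0 oner_eq0.
  rewrite scale_vec3 => /vec3_inj[]; rewrite mulr1 => <-.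
  by rewrite !mul1r => -> ->.
have aff_inf y z : affine_point y z != infinite_point F.
  apply/eqP => /eq_vlineP[|k k0]; first by rewrite vec3_eq0 oner_eq0.
  by rewrite scale_vec3 => /vec3_inj[/eqP]; rewrite mulr0 oner_eq0.
rewrite -(card_imset _ aff_inj) -[LHS](cardsID [set infinite_point F]) addnC.
congr (_ + _)%N; last first.
  case: (eqVneq c 0) => [c0|c0].
    rewrite -[RHS](cards1 (infinite_point F)).
    apply: eq_card => P; rewrite !inE.
    apply/andP/eqP => [[]//|->]; first by move=> _ /eqP.
    rewrite -memvE vec3_dual_line c0 !mulr0 mul0r !addr0 eqxx.
    by have := infinite_point_rational iota; rewrite inE => ->; rewrite eqxx.
  apply: eq_card0 => P; rewrite !inE; apply/negP => /andP[/andP[_ Pl] /eqP Pi].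
  move: Pl; rewrite Pi -memvE vec3_dual_line !mulr0 !add0r mulr1.
  by rewrite (negPf c0).
apply: eq_card => P; rewrite in_setD in_set1 in_set.
apply/and3P/imsetP => [[Pi PB Pl]|[[y z]]].
  case/BH_rational_pointsP: PB (Pi) => // [->|[y [z [defP nsq]]] _].
    by rewrite eqxx.
  exists (y, z) => //; rewrite inE /= nsq andbT.
  by move: Pl; rewrite defP -memvE vec3_dual_line mulr1.
rewrite inE /= => /andP[e nsq] ->; rewrite aff_inf affine_point_rational // nsq.
by rewrite -memvE vec3_dual_line mulr1.
Qed.

(** Each line has exactly one coefficient vector whose last nonzero entry
    is 1. *)
Definition normal_coord (x : F * F + F + unit) : 'rV[F]_3 :=
  match x with
  | inl (inl (a, b)) => vec3 a b 1
  | inl (inr a) => vec3 a 1 0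
  | inr _ => vec3 1 0 0
  end.

(** Up to a square factor, the value at the line of the form dual to
    [y^2 - 4 x z]: it vanishes when the line is tangent to the conic. *)
Definition dual_disc (x : F * F + F + unit) : F :=
  match x with
  | inl (inl (a, b)) => 4%:R * (b ^+ 2 - a)
  | inl (inr a) => 1
  | inr _ => 0
  end.

Lemma nzsq1 : nzsq (1 : F).
Proof. by apply/nzsqP; exists 1; rewrite ?oner_eq0 ?expr1n. Qed.

(** On the line [a + b y + z = 0] of the affine chart, [z] is determined by [y]
    and completing the square in [y^2 - 4 z] yields [Y^2 - D].  On [y = - a],
    [y^2 - 4 z] takes every value once. *)
Lemma card_BH_line x :
  #|[set P in BH_rational_points iota #|F| |
      (P <= dual_line (normal_coord x))%VS]|
  = section_size (dual_disc x).
Proof.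
case: x => [[[a b]|a]|[]]; rewrite card_BH_dual_line /=.
- rewrite oner_eq0 addn0 -card_not_nzsq_shift.
  pose f (y : F) := (y - 2%:R * b, - (a + b * (y - 2%:R * b))).
  have f_inj : injective f by move=> y y' [/addIr].
  rewrite -(card_imset _ f_inj); apply: eq_card => -[y z]; rewrite inE /=.
  apply/andP/imsetP => [[/eqP e nsq]|[t]].
    have ze : z = - (a + b * y).
      by apply/eqP; rewrite -subr_eq0 opprK addrC -[z]mul1r e.
    exists (y + 2%:R * b); last by rewrite /f addrK ze.
    rewrite inE; move: nsq; rewrite ze; congr (~~ nzsq _); ring.
  rewrite inE => nsq [-> ->]; split; first by apply/eqP; ring.
  by move: nsq; congr (~~ nzsq _); ring.
- rewrite eqxx /section_size oner_eq0 nzsq1.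
  pose f (u : F) := (- a, (a ^+ 2 - u) / 4%:R).
  have f_inj : injective f by move=> u v [/(divIf four0)/addrI/oppr_inj].
  have -> : [set p : F * F | (a + 1 * p.1 + 0 * p.2 == 0) &
       ~~ nzsq (p.1 ^+ 2 - 4%:R * p.2)] = f @: [set u | ~~ nzsq u].
    apply/setP => -[y z]; rewrite inE /= mul1r mul0r addr0 addr_eq0 -eqr_oppLR.
    apply/andP/imsetP => [[/eqP <- nsq]|[u]].
      exists (a ^+ 2 - 4%:R * z); first by rewrite inE -sqrrN.
      by congr (_, _); field; rewrite four0.
    rewrite inE => nsq [-> ->]; split=> //.
    by move: nsq; congr (~~ nzsq _); field; rewrite four0.
  rewrite card_imset // cardsNC; have := double_card_squares two0.
  by have := finNzRing_gt1 F; move: oddF; move: #|F| #|_| => n m; lia.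
- rewrite eqxx /section_size eqxx [X in (X + _)%N]eq_card0 // => -[y z].
  by rewrite inE /= !mul0r !addr0 oner_eq0.
Qed.

(** Which of the coordinate points a line contains determines the shape of its
    normalised vector; the points of the form [(1, 0, w)], [(0, 1, w)] and
    [(1, w, 0)] on it then give the entries. *)
Lemma normal_line_inj : injective (fun x => dual_line (normal_coord x)).
Proof.
move=> x x' e.
have m u v w : (vec3 u v w \in dual_line (normal_coord x)) =
  (vec3 u v w \in dual_line (normal_coord x')) by rewrite e.
case: x m {e} => [[[a b]|a]|[]]; case: x' => [[[a' b']|a']|[]] //= m.
- move: (m 1 0 (- a)) (m 0 1 (- b)); rewrite !vec3_dual_line.
  rewrite !mulr0 !mulr1 !mul1r !add0r !addr0 !subrr !eqxx !subr_eq0.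
  by move=> /esym/eqP -> /esym/eqP ->.
- move: (m 0 0 1); rewrite !vec3_dual_line.
  by rewrite !mulr0 !mulr1 !add0r oner_eq0 eqxx.
- move: (m 0 0 1); rewrite !vec3_dual_line.
  by rewrite !mulr0 !mulr1 !add0r oner_eq0 eqxx.
- move: (m 0 0 1); rewrite !vec3_dual_line.
  by rewrite !mulr0 !mulr1 !add0r oner_eq0 eqxx.
- move: (m 1 (- a) 0); rewrite !vec3_dual_line.
  by rewrite !mulr0 !mulr1 !mul1r !addr0 subrr eqxx subr_eq0 => /esym/eqP ->.
- move: (m 0 1 0); rewrite !vec3_dual_line.
  by rewrite !mulr0 !mulr1 !addr0 !add0r oner_eq0 eqxx.
- move: (m 0 0 1); rewrite !vec3_dual_line.
  by rewrite !mulr0 !mulr1 !add0r oner_eq0 eqxx.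
- move: (m 0 1 0); rewrite !vec3_dual_line.
  by rewrite !mulr0 !mulr1 !addr0 !add0r oner_eq0 eqxx.
Qed.

Lemma is_line_normal (l : plane F) :
  is_line l -> exists x, l = dual_line (normal_coord x).
Proof.
case/lineP => w; rewrite (vec3_eta w); move: (w 0 0) (w 0 1) (w 0 2) => a b c.
move=> w0 ->.
suff [k [x [k0 ->]]] : exists k x, k != 0 /\ vec3 a b c = k *: normal_coord x.
  by exists x; rewrite dual_lineZ.
have [c0|c0] := eqVneq c 0; last first.
  exists c, (inl (inl (a / c, b / c))); split=> //=.
  by rewrite scale_vec3 mulr1 ![c * _]mulrC !divfK.
have [b0|b0] := eqVneq b 0; last first.
  exists b, (inl (inr (a / b))); split=> //=.
  by rewrite scale_vec3 mulr1 mulr0 mulrC divfK // c0.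
exists a, (inr tt); split.
  by move: w0; rewrite b0 c0 vec3_eq0 eqxx !andbT.
by rewrite scale_vec3 mulr1 !mulr0 b0 c0.
Qed.

Lemma normal_is_line x : is_line (dual_line (normal_coord x)).
Proof.
apply/lineP; exists (normal_coord x) => //.
by case: x => [[[a b]|a]|[]]; rewrite vec3_eq0 oner_eq0 ?andbF.
Qed.

(** For fixed [b], the map [a |-> 4 (b^2 - a)] is a bijection of [F]. *)
Lemma card_dual_disc (P : pred F) :
  #|[set x | P (dual_disc x)]| =
  (#|F| * #|[set D | P D]| + #|F| * P 1%R + P 0%R)%N.
Proof.
rewrite 2!card_sum_type /=; congr (_ + _ + _)%N.
- pose f (p : F * F) := (p.1 ^+ 2 - p.2 / 4%:R, p.1).
  have f_inj : injective f.
    move=> [b D] [b' D'] [/= + eb]; rewrite eb.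
    by move/addrI/oppr_inj/(divIf four0) => ->.
  rewrite -cardsT -cardsX -(card_imset _ f_inj); apply: eq_card => -[a b].
  rewrite inE; apply/idP/imsetP => [pab|[[b' D]]].
    exists (b, 4%:R * (b ^+ 2 - a)); first by rewrite !inE.
    by congr (_, _) => /=; field; rewrite four0.
  rewrite !inE => /= PD [-> ->]; move: PD; congr (P _).
  by field; rewrite four0.
- exact: card_set_const.
- by rewrite card_set_const card_unit mul1n.
Qed.

Lemma tauE (i : nat) :
  tau iota #|F| i = (#|F| * #|[set D : F | section_size D == i]| +
    #|F| * (section_size (1%R : F) == i) + (section_size (0%R : F) == i))%N.
Proof.
rewrite -(card_dual_disc (fun D => section_size D == i)).
rewrite /tau -(card_imset _ normal_line_inj); apply: eq_card => l.
rewrite inE; apply/andP/imsetP => [[ll]|[x]].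
  have [x ->] := is_line_normal ll; rewrite card_BH_line => Hx.
  by exists x; rewrite ?inE.
by rewrite inE => Hx ->; rewrite normal_is_line card_BH_line.
Qed.

End Lines.

(** * The number of lines of each type *)

Local Close Scope ring_scope.

Theorem corollary3p4 (q : nat) (F : finFieldType) (cardF : #|F| = q)
    (q_odd : odd q) (K : closedFieldType) (iota : {rmorphism F -> K}) :
  (forall i : nat, tau iota q i <> 0 ->
     i = 1 \/ i = (q + 1) %/ 2 \/ i = (q + 3) %/ 2) /\
  (tau iota q 1 = q + 1 /\
   tau iota q ((q + 1) %/ 2) = (q * (q - 1)) %/ 2 /\
   tau iota q ((q + 3) %/ 2) = (q * (q + 1)) %/ 2).
Proof.
subst q; have two0 := two_neq0 q_odd.
(* q = 2 m + 1, with m nonzero: this keeps 1 distinct from (q + 1) / 2. *)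
have [m qE m0] : exists2 m, #|F| = m.*2.+1 & (0 < m).
  exists #|F|./2; first by rewrite -[LHS]odd_double_half q_odd.
  by have := finNzRing_gt1 F; move: q_odd; move: #|F| => n; lia.
have sizeE (D : F) : section_size D =
    if D == 0%R then 1 else if nzsq D then m.+2 else m.+1.
  by rewrite /section_size qE; case: eqP => // _; case: nzsq; lia.
have nsq0 : ~~ nzsq (0%R : F).
  by apply/nzsqP => -[d d0 /esym/eqP]; rewrite expf_eq0 (negPf d0).
have size1 : section_size (1%R : F) = m.+2 by rewrite sizeE oner_eq0 nzsq1.
have size0 : section_size (0%R : F) = 1 by rewrite sizeE eqxx.
have cards_sq : #|[set D : F | nzsq D]| = m.
  by have := double_card_squares two0; rewrite qE; lia.
have card1 : #|[set D : F | section_size D == 1]| = 1.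
  rewrite -[RHS](cards1 (0%R : F)); apply: eq_card => D; rewrite !inE sizeE.
  by case: (D == 0%R) => //; case: nzsq; lia.
have card3 : #|[set D : F | section_size D == m.+2]| = m.
  rewrite -[RHS]cards_sq; apply: eq_card => D; rewrite !inE sizeE.
  by case: (eqVneq D 0%R) => [->|_]; [rewrite (negPf nsq0)|case: nzsq]; lia.
have card2 : #|[set D : F | section_size D == m.+1]| = m.
  have -> : [set D : F | section_size D == m.+1] =
      ~: ([set D | nzsq D] :|: [set 0%R]).
    apply/setP => D; rewrite !inE sizeE.
    by case: (eqVneq D 0%R) => _; rewrite ?orbT; [|case: nzsq]; lia.
  rewrite cardsCs setCK cardsU cards_sq cards1 qE.
  have -> : [set D : F | nzsq D] :&: [set 0%R] = set0.
    apply/setP => D; rewrite !inE.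
    by apply/negP => /andP[h /eqP D0]; move: nsq0; rewrite -D0 h.
  by rewrite cards0; lia.
split=> [i|].
  rewrite (tauE iota q_odd) size1 size0.
  case: (eqVneq m.+2 i) => [<- _|i3]; first by rewrite qE; lia.
  case: (eqVneq 1 i) => [<- _|i1]; first by left.
  case: (set_0Vmem [set D : F | section_size D == i]) => [-> |[D]].
    by rewrite cards0; lia.
  rewrite inE sizeE => /eqP <- _; rewrite qE.
  by case: eqP => _; [|case: nzsq]; lia.
have -> : ((#|F| + 1) %/ 2) = m.+1 by rewrite qE; lia.
have -> : ((#|F| + 3) %/ 2) = m.+2 by rewrite qE; lia.
rewrite !(tauE iota q_odd) size1 size0 card1 card2 card3 qE.
do !split; nia.
Qed.
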